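(* Let $\mathcal{R}_d=\mathcal{H}_d\mathcal{F}_d\mathcal{H}_d^{-1}$ be the matrix transforming the $h$-vector of a $(d-1)$-dimensional simplicial complex $\Delta$ into the $h$-vector of $\mathrm{Int}(\Delta)$. Then for all $0\le r,s\le d$ the entry of $\mathcal{R}_d$ in row $r$ and column $s$ is $B^+(d+1,s+1,r)$. Thus, for every $(d-1)$-dimensional simplicial complex $\Delta$ and every $0\le r\le d$, $$h_r(\mathrm{Int}(\Delta))=\sum_{s=0}^{d}B^+(d+1,s+1,r)\,h_s(\Delta).$$
   Context: Simplicial complexes are finite abstract simplicial complexes on a ground set $[n]$, containing the empty face $\emptyset$ (of dimension $-1$). For a $(d-1)$-dimensional $\Delta$, $f_i(\Delta)$ is the number of $i$-dimensional faces ($f_{-1}(\Delta)=1$), $f(\Delta)=(f_{-1}(\Delta),\ldots,f_{d-1}(\Delta))$, and $h(\Delta)=(h_0(\Delta),\ldots,h_d(\Delta))$ with $h_k(\Delta)=\sum_{i=0}^{k}(-1)^{k-i}\binom{d-i}{k-i}f_{i-1}(\Delta)$. Interval subdivision: let $I(\Delta\setminus\{\emptyset\})=\{[A,B] : \emptyset\ne A\subseteq B\in\Delta\}$, partially ordered by $[A,B]\subseteq[A',B']$ iff $A'\subseteq A\subseteq B\subseteq B'$. $\mathrm{Int}(\Delta)$ is the simplicial complex on the ground set $I(\Delta\setminus\{\emptyset\})$ whose faces are all chains of this poset. Matrices (rows and columns indexed by $0,\ldots,d$, vectors being column vectors): $\mathcal{H}_d$ is the matrix with $h(\Delta)=\mathcal{H}_d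 f(\Delta)$, i.e. its $(i,j)$ entry is $(-1)^{i+j}\binom{d-j}{i-j}$, and $\mathcal{H}_d^{-1}$ has $(i,j)$ entry $\binom{d-j}{i-j}$ (a binomial coefficient with negative lower index is $0$). $\mathcal{F}_d=[b_{k,l}]_{0\le k,l\le d}$, the matrix with $f(\mathrm{Int}(\Delta))=\mathcal{F}_d f(\Delta)$, is given by $b_{0,0}=1$, $b_{0,l}=0$ for $l>0$, and $b_{k,l}=\sum_{j=0}^{k-1}(-1)^j\binom{k-1}{j}\big[(2k-2j)^l-(2k-2j-1)^l\big]$ for $1\le k\le d$. Signed permutations: $B_m$ is the group of bijections $\sigma$ of $\{\pm1,\ldots,\pm m\}$ with $\sigma_{-i}=-\sigma_i$, written $\sigma=\sigma_1\cdots\sigma_m$. With $\sigma_0=0$, $\mathrm{Des}_B(\sigma)=\{i\in\{0,\ldots,m-1\}:\sigma_i>\sigma_{i+1}\}$ and $\mathrm{des}_B(\sigma)=|\mathrm{Des}_B(\sigma)|$. For $j\in\{\pm1,\ldots,\pm m\}$, $B^+(m,j,r)$ is the number of $\sigma\in B_m$ with $\sigma_1=j$, $\sigma_m>0$ and $\mathrm{des}_B(\sigma)=r$. *)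

(* Defs.v *)
From HB Require Import structures.
From mathcomp Require Import all_boot all_order all_algebra all_fingroup.

Set Implicit Arguments.
Unset Strict Implicit.
Unset Printing Implicit Defensive.

Import Order.TTheory GRing.Theory Num.Theory.
Local Open Scope ring_scope.

Section Complexes.
Variable T : finType.
Implicit Types (D C : {set {set T}}) (x y : {set T} * {set T}).

(* Points of T need not be vertices of D. *)
Definition is_complex D : Prop :=
  set0 \in D /\ (forall A B : {set T}, A \subset B -> B \in D -> A \in D).

(* The "d" of a (d-1)-dimensional complex: one more than its dimension. *)
Definition dim_succ D : nat := \max_(A in D) #|A|.

(* fnum D i is f_{i-1}(D): faces are counted by cardinality. *)
Definition fnum D (i : nat) : nat := #|[set A in D | #|A| == i]|.

Definition hnum D (k : nat) : int :=
  \sum_(i < k.+1)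
    (-1) ^+ (k - i) * ('C(dim_succ D - i, k - i)%N)%:Z * (fnum D i)%:Z.

(* The pair (A, B) stands for the interval [A, B]. *)
Definition intervals D : {set {set T} * {set T}} :=
  [set x : {set T} * {set T} | [&& x.1 != set0, x.1 \subset x.2 & x.2 \in D]].

Definition interval_le x y : bool :=
  [&& y.1 \subset x.1, x.1 \subset x.2 & x.2 \subset y.2].

(* The ground set "intervals D" is a subset of the ambient finite type of
   pairs; no pair outside it occurs in a face. *)
Definition Int D : {set {set {set T} * {set T}}} :=
  [set K : {set {set T} * {set T}} | (K \subset intervals D) &&
    [forall x in K, forall y in K, interval_le x y || interval_le y x]].

End Complexes.

Definition hvec (T : finType) (d : nat) (D : {set {set T}}) : 'cV[int]_d.+1 :=
  \col_(i < d.+1) hnum D i.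

(* The guard j <= i is needed because subtraction on nat is truncated. *)
Definition Hmx (d : nat) : 'M[int]_d.+1 :=
  \matrix_(i < d.+1, j < d.+1)
    if (j <= i)%N then (-1) ^+ (i + j) * ('C(d - j, i - j)%N)%:Z else 0.

Definition Fentry (k l : nat) : int :=
  if k is 0 then (l == 0)%:Z
  else \sum_(j < k) (-1) ^+ j * ('C(k.-1, j)%N)%:Z *
         ((2 * k%:Z - 2 * j%:Z) ^+ l - (2 * k%:Z - 2 * j%:Z - 1) ^+ l).

Definition Fmx (d : nat) : 'M[int]_d.+1 :=
  \matrix_(k < d.+1, l < d.+1) Fentry k l.

(* Hmx d is unitriangular, so invmx is its inverse over int. *)
Definition Rmx (d : nat) : 'M[int]_d.+1 := Hmx d *m Fmx d *m invmx (Hmx d).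

Section SignedPermutations.
Variable m : nat.

(* The set {+-1, ..., +-m}: (b, i) stands for (-1)^b (i + 1). *)
Definition pm : finType := (bool * 'I_m)%type.

Definition pm_val (x : pm) : int := (-1) ^+ x.1 * (x.2.+1)%:Z.

Definition pm_opp (x : pm) : pm := (~~ x.1, x.2).

Definition signed_perms : {set {perm pm}} :=
  [set s : {perm pm} | [forall x, s (pm_opp x) == pm_opp (s x)]].

(* The word 0 :: sigma_1 ... sigma_m, so that entry i is sigma_i with
   sigma_0 = 0. *)
Definition sword (s : {perm pm}) : seq int :=
  0 :: [seq pm_val (s (false, i)) | i <- enum 'I_m].

Definition Des_B (s : {perm pm}) : {set 'I_m} :=
  [set i : 'I_m | (sword s)`_i > (sword s)`_i.+1].

Definition des_B (s : {perm pm}) : nat := #|Des_B s|.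

Definition Bplus (j : int) (r : nat) : nat :=
  #|[set s in signed_perms |
      [&& (sword s)`_1 == j, 0 < (sword s)`_m & des_B s == r]]|.

End SignedPermutations.

(* Main.v *)
Require Import Defs.
From HB Require Import structures.
From mathcomp Require Import all_boot all_order all_algebra all_fingroup.
From mathcomp Require Import zify ring.
Import Order.TTheory GRing.Theory Num.Theory.
Local Open Scope ring_scope.

Set Implicit Arguments.
Unset Strict Implicit.
Unset Printing Implicit Defensive.

(** Both halves of the theorem come from counting colourings of a finite set
    X by pairs (sign, level) with 0 <= level <= k, where the sign true
    stands for minus and (true, 0) never occurs, so that the colours are the
    2k + 1 integers from -k to k.  The colourings of interest are those that are onto in the following sense: the
    colour (false, k) is used and every level strictly between 0 and k is used
    with one sign or the other.  Inclusion-exclusion over the k - 1 middle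
    levels ([card_onto]) counts them by an alternating sum of the shape of the
    entries of the matrix F_d.

    Chains of intervals.  A chain [A_1, B_1] < ... < [A_k, B_k] is a decreasing
    sequence of sets A_i together with a decreasing sequence of complements of
    the B_i.  Colour a point by (false, j) if it lies in A_1, ..., A_j only, by
    (true, j) if it misses B_1, ..., B_j only, and give it level 0 if it lies in
    B_1 but not in A_1.  Strictness of the chain says that every middle level is
    used, and A_k being nonempty says that (false, k) is used; so the chains of
    Int(D) of size k > 0 are the onto colourings for which the points not coloured
    (true, k) form a face of D ([card_Int_faces]).  Hence
    f(Int(D)) = F_d f(D) ([fnum_Int]); Int(D) and D also have the same
    dimension ([dim_succ_Int]).

    Signed permutations.  Let M = H_d^-1.  The claim H F M = B is equivalent to
    F M = M B, which is proved entry by entry ([Fentry_Bplus]).  The entry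
    (k, s) of M B counts the signed permutations of {1, ..., d + 1} that start
    with s + 1, end with a positive letter, and are cut at k gaps including
    all descents.  The cuts make k + 1 increasing blocks; colour a value by the
    sign with which it occurs and by the index of its block.  As the first
    block increases from s + 1, values below s + 1 are not in it and values
    above s + 1 occur in it only positively; as the last block ends with its
    maximum, the last letter is positive exactly when (false, k) is used.
    Sorting by block, then by signed value, recovers the word, so that the cut
    permutations are again onto colourings ([card_cut_perms]).  Evaluated by
    [card_onto], the count is the entry (k, s) of F M, since
    sum_l a^l C(d - s, l - s) = a^s (a + 1)^(d - s). *)

(** * Inclusion-exclusion for colourings *)

(** Multiplying out a product of complements is inclusion-exclusion. *)
Lemma prod1B_subsets (R : comNzRingType) (T : finType) (I : {set T}) (b : T -> R) :
  \prod_(i in I) (1 - b i) =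
  \sum_(J in powerset I) (-1) ^+ #|J| * \prod_(i in J) b i.
Proof.
transitivity (\prod_i ((if i \in I then - b i else 0) + 1)).
  rewrite [LHS]big_mkcond; apply: eq_bigr => i _.
  by case: ifP => _; rewrite ?add0r // addrC.
rewrite bigA_distr [RHS]big_mkcond; apply: eq_bigr => J _.
rewrite inE -big_mkcond; case: ifPn => [/subsetP JI | /subsetPn [i iJ iNI]].
  rewrite -prodrN; apply: eq_bigr => i iJ.
  by rewrite JI.
by rewrite (bigD1 i) //= (negPf iNI) mul0r.
Qed.

Lemma sum_powerset_card (R : nzRingType) (T : finType) (I : {set T}) (F : nat -> R) :
  \sum_(J in powerset I) F #|J| = \sum_(j < #|I|.+1) ('C(#|I|, j))%:R * F j.
Proof.
rewrite (partition_big (fun J : {set T} => inord #|J| : 'I_#|I|.+1) predT) //=.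
apply: eq_bigr => j _; rewrite -cards_draws mulr_natl.
rewrite (eq_bigr (fun=> F j)) => [|J /andP[]].
  rewrite sumr_const; congr (_ *+ _); apply: eq_card => J.
  rewrite unfold_in /= !inE; case JI: (J \subset I) => //=.
  by rewrite -val_eqE /= inordK // ltnS subset_leq_card.
rewrite inE => JI /eqP <-; by rewrite inordK // ltnS subset_leq_card.
Qed.

Lemma card_ffun_in (X V : finType) (Q : X -> {set V}) :
  #|[set g : {ffun X -> V} | [forall x, g x \in Q x]]| = (\prod_x #|Q x|)%N.
Proof.
under [RHS]eq_bigr => x _ do rewrite -sum1_card.
rewrite bigA_distr_big_dep -sum1_card; apply: eq_big => [g|g _]; last by rewrite big1.
rewrite inE; apply/forallP/familyP => /= gQ x; exact: gQ.
Qed.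

Section Onto.
Variables (X : finType) (k : nat).

Definition colour := (bool * 'I_k.+1)%type.
Definition top_colour : colour := (false, ord_max).
Definition middle_levels : {set 'I_k.+1} := [set j : 'I_k.+1 | (0 < j < k)%N].

Definition onto (g : {ffun X -> colour}) : bool :=
  [exists x, g x == top_colour] && [forall j in middle_levels, exists x, (g x).2 == j].

Definition colourings (Q : X -> {set colour}) : {set {ffun X -> colour}} :=
  [set g : {ffun X -> colour} | [forall x, g x \in Q x]].

Lemma card_middle_levels : #|middle_levels| = k.-1.
Proof.
have -> : middle_levels = ~: [set ord0; ord_max].
  apply/setP=> j; rewrite !inE -!val_eqE /=; have := ltn_ord j; lia.
rewrite cardsCs setCK cards2 card_ord -val_eqE /=; lia.
Qed.

(** For a single colouring, the indicator of being onto is a product of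
    complements of indicators, one for each middle level and one for the top
    colour; expanding the product over the middle levels and summing over A
    gives the two counts on the right. *)
Lemma sum_ontoE (A : {set {ffun X -> colour}}) :
  #|[set g in A | onto g]|%:Z =
  \sum_(J in powerset middle_levels) (-1) ^+ #|J| *
    (#|[set g in A | [forall x, (g x).2 \notin J]]|%:Z -
     #|[set g in A | [forall x, ((g x).2 \notin J) && (g x != top_colour)]]|%:Z).
Proof.
have cardZ (B : {set {ffun X -> colour}}) (p : pred _) :
    #|[set g in B | p g]|%:Z = \sum_(g in B) (p g)%:R.
  rewrite -sum1_card -natz natr_sum (eq_bigl (fun g => (g \in B) && p g)); last first.
    by move=> g; rewrite inE.
  by rewrite big_mkcondr; apply: eq_bigr => g _; case: (p g).
rewrite cardZ; under [RHS]eq_bigr => J _ do rewrite !cardZ -sumrB mulr_sumr.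
rewrite exchange_big; apply: eq_bigr => g _ /=.
pose t : int := [forall x, g x != top_colour]%:R.
pose a (j : 'I_k.+1) : int := [forall x, (g x).2 != j]%:R.
have natr_forall (T : finType) (B : {set T}) (p : T -> bool) :
    [forall j in B, p j]%:R = \prod_(j in B) (p j)%:R :> int.
  have [/forall_inP pB | /forall_inPn [j jB npj]] := boolP [forall j in B, p j].
    by rewrite big1 // => j jB; rewrite pB.
  by rewrite (bigD1 j) //= (negPf npj) mul0r.
have natr_exists (p : X -> bool) :
    [exists x, p x]%:R = 1 - [forall x, ~~ p x]%:R :> int.
  by rewrite -negb_exists; case: [exists x, p x]; rewrite ?subr0 ?subrr.
have prod_a (J : {set 'I_k.+1}) : \prod_(j in J) a j = [forall x, (g x).2 \notin J]%:R.
  rewrite -natr_forall; congr (_%:R); congr nat_of_bool.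
  apply/forall_inP/forallP => [gJ x | gJ j jJ]; last first.
    by apply/forallP=> x; apply: contraNneq (gJ x) => ->.
  by apply/negP=> /gJ /forallP /(_ x); rewrite eqxx.
transitivity ((1 - t) * \prod_(j in middle_levels) (1 - a j)).
  rewrite /onto -mulnb natrM; congr (_ * _).
    by rewrite natr_exists.
  by rewrite natr_forall; apply: eq_bigr => j _; rewrite natr_exists.
rewrite prod1B_subsets mulr_sumr; apply: eq_bigr => J _.
rewrite prod_a mulrCA; congr (_ * _).
rewrite mulrBl mul1r; congr (_ - _).
rewrite /t -natrM mulnb; congr (_%:R); congr nat_of_bool.
apply/andP/forallP => [[/forallP gt /forallP gJ] x | gJt]; first by rewrite gJ gt.
by split; apply/forallP=> x; case/andP: (gJt x).
Qed.

(** The set P consists of the points that may take any colour of W; the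
    remaining points have a prescribed colour outside W and contribute factors
    1.  So only the sizes of W and of the Q x enter the count. *)
Lemma card_avoiding (Q : X -> {set colour}) (P : {set X}) (W : {set colour}) :
    {in P, forall x, W \subset Q x} ->
    {in ~: P, forall x, exists2 c, Q x = [set c] & c \notin W} ->
  #|[set g in colourings Q | [forall x, g x \notin W]]|%:Z =
  \prod_(x in P) (#|Q x|%:Z - #|W|%:Z).
Proof.
move=> QP QNP.
have -> : [set g in colourings Q | [forall x, g x \notin W]] =
          colourings (fun x => Q x :\: W).
  apply/setP=> g; rewrite !inE; apply/andP/forallP => [[/forallP gQ /forallP gW] x | gQ].
    by rewrite inE gQ gW.
  by split; apply/forallP=> x; have := gQ x; rewrite inE => /andP[].
rewrite card_ffun_in -natz natr_prod [RHS]big_mkcond.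
apply: eq_bigr => x _; rewrite natz; case: ifPn => xP.
  have sWQ := QP x xP; rewrite cardsD (setIidPr sWQ) subzn //.
  exact: subset_leq_card.
have [|c -> cW] := QNP x; first by rewrite inE.
by rewrite (setDidPl _) ?cards1 // disjoints1.
Qed.

(** Avoiding the levels of J removes 2 * #|J| colours from each point of P,
    and avoiding the top colour as well removes one more; there are
    'C(k.-1, j) sets J of size j.  The alternating sum has the shape of
    [Fentry], which is why it serves both chains and permutations. *)
Lemma card_onto (Q : X -> {set colour}) (P : {set X}) :
    (0 < k)%N ->
    {in P, forall x, top_colour \in Q x /\ forall c, c.2 \in middle_levels -> c \in Q x} ->
    {in ~: P, forall x, exists c, [/\ Q x = [set c], c != top_colour & c.2 \notin middle_levels]} ->
  #|[set g in colourings Q | onto g]|%:Z =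
  \sum_(j < k) (-1) ^+ j * 'C(k.-1, j)%:Z *
     (\prod_(x in P) (#|Q x|%:Z - 2 * j%:Z)
      - \prod_(x in P) (#|Q x|%:Z - 2 * j%:Z - 1)).
Proof.
move=> k0 QP QNP; rewrite sum_ontoE.
pose F j : int := (-1) ^+ j * (\prod_(x in P) (#|Q x|%:Z - 2 * j%:Z)
      - \prod_(x in P) (#|Q x|%:Z - 2 * j%:Z - 1)).
rewrite (eq_bigr (fun J : {set _} => F #|J|)) => [|J].
  rewrite sum_powerset_card card_middle_levels prednK //; apply: eq_bigr => j _.
  by rewrite /F natz; ring.
rewrite inE => /subsetP JM.
(* W collects both signs of each avoided level. *)
pose W := [set c : colour | c.2 \in J].
have topW : top_colour \notin W.
  by rewrite inE; apply/negP=> /JM; rewrite inE /= ltnn andbF.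
have cardW : #|W| = (2 * #|J|)%N.
  have -> : W = setX setT J by apply/setP=> -[b i]; rewrite !inE.
  by rewrite cardsX cardsT card_bool.
have WQ : {in P, forall x, W \subset Q x}.
  move=> x /QP[_ mQ]; apply/subsetP=> c; rewrite inE => /JM; exact: mQ.
have WNQ : {in ~: P, forall x, exists c, [/\ Q x = [set c], c \notin W & c != top_colour]}.
  move=> x /QNP[c [-> ct cm]]; exists c; split=> //.
  by rewrite inE; apply: contra cm; apply: JM.
congr (_ * (_ - _)).
  transitivity #|[set g in colourings Q | [forall x, g x \notin W]]|%:Z.
    congr (Posz _); apply: eq_card => g; rewrite !inE; congr (_ && _).
    by apply: eq_forallb => x; rewrite inE.
  rewrite (card_avoiding (P := P)) // => [|x /WNQ[c [Qc cW _]]]; last by exists c.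
  by rewrite cardW PoszM.
transitivity #|[set g in colourings Q | [forall x, g x \notin top_colour |: W]]|%:Z.
  congr (Posz _); apply: eq_card => g; rewrite !inE; congr (_ && _).
  by apply: eq_forallb => x; rewrite !inE negb_or andbC.
rewrite (card_avoiding (P := P)).
- by apply: eq_bigr => x _; rewrite cardsU1 topW cardW; lia.
- by move=> x xP; rewrite subUset sub1set (QP x xP).1 WQ.
- by move=> x /WNQ[c [Qc cW ct]]; exists c; rewrite // !inE negb_or ct; rewrite inE in cW.
Qed.
End Onto.

(** * Chains of intervals as colourings *)

Lemma card_ord_lt n m : (m <= n)%N -> #|[set i : 'I_n | (i < m)%N]| = m.
Proof.
move=> mn; rewrite -sum1_card (eq_bigl (fun i : 'I_n => (i < m)%N)) => [|i]; last by rewrite inE.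
by rewrite (big_ord_narrow mn) sum1_card card_ord.
Qed.

Lemma card_ord_gt0_le n m : (m < n)%N -> #|[set i : 'I_n | (0 < i <= m)%N]| = m.
Proof.
case: n => // n mn; have := card_ord_lt mn.
rewrite (cardsD1 ord0) inE add1n => -[E]; rewrite -[RHS]E.
by apply: eq_card => i; rewrite !inE -val_eqE /= lt0n.
Qed.

Lemma card_ord_gt0 n : #|[set i : 'I_n.+1 | (0 < i)%N]| = n.
Proof.
rewrite -[RHS](card_ord_gt0_le (ltnSn n)); apply: eq_card => i.
by rewrite !inE -[(i <= n)%N]ltnS ltn_ord andbT.
Qed.

Section Chains.
Variables (T : finType) (k : nat).
Implicit Types (D : {set {set T}}) (g : {ffun T -> colour k}).
Implicit Types (I J : {set T} * {set T}) (K : {set {set T} * {set T}}).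

(** [lower_end g i] and [upper_end g i] are the ends A_i and B_i of the i-th
    interval of the chain coded by g. *)
Definition lower_end g (i : nat) : {set T} := [set x | ~~ (g x).1 && (i <= (g x).2)%N].
Definition upper_end g (i : nat) : {set T} := [set x | ~~ ((g x).1 && (i <= (g x).2)%N)].

Definition level_chain g : {set {set T} * {set T}} :=
  [set (lower_end g i, upper_end g i) | i : 'I_k.+1 & (0 < i)%N].

(** A point lies in the difference of the ends of the larger intervals and
    leaves it as the intervals shrink; its level is the number of intervals
    whose difference it has left. *)
Definition leaves I x := (x \in I.1) || (x \notin I.2).
Definition depth_colouring K : {ffun T -> colour k} :=
  [ffun x => ([exists I in K, x \notin I.2], inord #|[set I in K | leaves I x]|)].

Definition chain_colourings D : {set {ffun T -> colour k}} :=
  [set g : {ffun T -> colour k} | [&& [forall x, g x != (true, ord0)], onto g &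
               [set x | g x != (true, ord_max)] \in D]].

Lemma upper_endE g : upper_end g k = [set x | g x != (true, ord_max)].
Proof.
apply/setP=> x; rewrite !inE; case: (g x) => b i /=.
by rewrite xpair_eqE eqb_id -val_eqE /= eqn_leq -[(i <= k)%N]ltnS ltn_ord; case: b.
Qed.

(** If the i-th and j-th intervals agree for i < j, then no point has level i,
    because such a point is in A_i and not in A_j, or in B_j and not in B_i. *)
Lemma level_chain_inj D g (i j : 'I_k.+1) : g \in chain_colourings D ->
  (0 < i)%N -> (0 < j)%N ->
  (lower_end g i, upper_end g i) = (lower_end g j, upper_end g j) -> i = j.
Proof.
rewrite inE => /and3P[_ /andP[_ /forall_inP gM] _].
wlog ij : i j / (i < j)%N => [hwlog i0 j0 eij|].
  have [/hwlog|/hwlog|/val_inj //] := ltngtP i j; first exact.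
  by move=> ->.
move=> i0 _ [/setP El /setP Eu].
have /existsP[x /eqP gx] : [exists x, (g x).2 == i].
  by apply: gM; rewrite inE i0 (leq_trans ij) // -ltnS.
have := El x; have := Eu x; rewrite !inE gx leqnn leqNgt ij /=.
by case: (g x).1.
Qed.

Lemma card_level_chain D g : g \in chain_colourings D ->
  #|level_chain g| = k.
Proof.
move=> gD; rewrite card_in_imset => [|i j]; last first.
  by rewrite !inE; exact: level_chain_inj gD.
by rewrite -[RHS]card_ord_gt0; apply: eq_card => i; rewrite !inE.
Qed.

Lemma lower_end_sub g i j : (i <= j)%N -> lower_end g j \subset lower_end g i.
Proof.
move=> ij; apply/subsetP=> x; rewrite !inE => /andP[-> /(leq_trans ij)]; exact.
Qed.

Lemma upper_end_sub g i j : (i <= j)%N -> upper_end g i \subset upper_end g j.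
Proof.
move=> ij; apply/subsetP=> x; rewrite !inE; apply: contra => /andP[-> /(leq_trans ij)]; exact.
Qed.

Lemma lower_upper_end g i j : lower_end g i \subset upper_end g j.
Proof. by apply/subsetP=> x; rewrite !inE; case: (g x).1. Qed.

Lemma level_chain_Int D g : is_complex D -> g \in chain_colourings D ->
  level_chain g \in Int D.
Proof.
move=> [_ Dsub] gD; rewrite inE; apply/andP; split.
  apply/subsetP=> _ /imsetP[i i0 ->]; rewrite inE /=; apply/and3P; split.
  - move: gD; rewrite inE => /and3P[_ /andP[/existsP[x /eqP gx] _] _].
    by apply/set0Pn; exists x; rewrite inE gx /= -ltnS.
  - exact: lower_upper_end.
  - apply: (Dsub _ (upper_end g k)); first by apply: upper_end_sub; rewrite -ltnS.
    by rewrite upper_endE; move: gD; rewrite inE => /and3P[].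
apply/forall_inP=> _ /imsetP[i i0 ->]; apply/forall_inP=> _ /imsetP[j j0 ->].
rewrite /interval_le /= !lower_upper_end //.
by case/orP: (leq_total i j) => ij; rewrite !(lower_end_sub _ ij) !(upper_end_sub _ ij) ?orbT.
Qed.

(** The intervals that a point leaves are those of index at most its level, so
    counting them returns the level. *)
Lemma level_chainK D g : g \in chain_colourings D ->
  depth_colouring (level_chain g) = g.
Proof.
move=> gD; apply/ffunP=> x; rewrite ffunE.
have g0 : g x != (true, ord0).
  by move: gD; rewrite inE => /and3P[/forallP/(_ x)].
have -> : [set I in level_chain g | leaves I x] =
  [set (lower_end g i, upper_end g i) | i : 'I_k.+1 & (0 < i <= (g x).2)%N].
  apply/setP=> I; rewrite inE; apply/andP/imsetP => [[/imsetP[i]]|[i]].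
    rewrite inE => i0 ->.
    rewrite /leaves !inE negbK => H; exists i => //; rewrite inE i0 /=.
    by case/orP: H => /andP[].
  rewrite inE => /andP[i0 ix] ->; split; first by apply/imsetP; exists i; rewrite ?inE.
  by rewrite /leaves !inE negbK ix !andbT orNb.
rewrite card_in_imset => [|i j]; last first.
  rewrite !inE => /andP[i0 _] /andP[j0 _]; exact: (level_chain_inj gD).
set c := #|_|; have -> : c = (g x).2; last rewrite {}/c.
  rewrite -[RHS](card_ord_gt0_le (ltn_ord (g x).2)).
  by apply: eq_card => i; rewrite !inE.
rewrite inord_val [RHS]surjective_pairing; congr (_, _).
apply/exists_inP/idP => [[_ /imsetP[i i0 ->]] | gx1].
  by rewrite inE negbK => /andP[].
have lx : (0 < (g x).2)%N.
  rewrite lt0n; apply: contra g0 => /eqP lx0.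
  by rewrite [g x]surjective_pairing xpair_eqE gx1 -val_eqE /= lx0.
exists (lower_end g (g x).2, upper_end g (g x).2).
  by apply/imsetP; exists (g x).2; rewrite ?inE.
by rewrite inE gx1 leqnn.
Qed.

(** The rank of I in the chain K is the index i under which I appears as
    (A_i, B_i). *)
Definition chain_rank K I := #|[set J in K | interval_le J I]|.

Section ChainInInt.
Variables (D : {set {set T}}) (K : {set {set T} * {set T}}).
Hypotheses (KD : K \in Int D) (Kk : #|K| = k).

Lemma chain_total I J : I \in K -> J \in K -> interval_le I J || interval_le J I.
Proof. by move=> IK JK; move: KD; rewrite inE => /andP[_ /forall_inP/(_ I IK)/forall_inP/(_ J JK)]. Qed.

Lemma chain_interval I : I \in K -> [&& I.1 != set0, I.1 \subset I.2 & I.2 \in D].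
Proof. by move=> IK; move: KD; rewrite inE => /andP[/subsetP/(_ I IK)]; rewrite inE. Qed.

Lemma chain_rank_gt0 I : I \in K -> (0 < chain_rank K I)%N.
Proof.
move=> IK; apply/card_gt0P; exists I; rewrite inE IK /interval_le !subxx andbT /=.
by case/and3P: (chain_interval IK).
Qed.

Lemma chain_rank_le I : (chain_rank K I <= k)%N.
Proof. by rewrite -Kk subset_leq_card //; apply/subsetP=> J; rewrite inE => /andP[]. Qed.

Definition depth x := #|[set I in K | leaves I x]|.

Lemma depth_colouringE x :
  ((depth_colouring K x).2 = depth x :> nat) *
  ((depth_colouring K x).1 = [exists I in K, x \notin I.2]).
Proof.
rewrite ffunE /= inordK // ltnS -Kk subset_leq_card //.
by apply/subsetP=> J; rewrite inE => /andP[].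
Qed.

Lemma rank_le_depth I x : (forall J, J \in K -> interval_le J I -> leaves J x) ->
  (chain_rank K I <= depth x)%N.
Proof.
move=> H; apply: subset_leq_card; apply/subsetP=> J; rewrite !inE => /andP[JK JI].
by rewrite JK H.
Qed.

(** If x leaves only intervals not above I, then these are strictly below I,
    and I itself makes the rank strictly larger. *)
Lemma depth_lt_rank I x : I \in K ->
  (forall J, J \in K -> leaves J x -> ~~ interval_le I J) -> (depth x < chain_rank K I)%N.
Proof.
move=> IK H; apply: proper_card; apply/properP; split.
  apply/subsetP=> J; rewrite !inE => /andP[JK Jx]; rewrite JK /=.
  by have := chain_total IK JK; rewrite (negPf (H J JK Jx)).
have II : interval_le I I by case/and3P: (chain_interval IK) => _ sI _; rewrite /interval_le !subxx sI.
exists I; first by rewrite inE IK.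
by rewrite inE IK /=; apply: contraL II; exact: H.
Qed.

Lemma lower_end_depth I : I \in K ->
  lower_end (depth_colouring K) (chain_rank K I) = I.1.
Proof.
move=> IK; apply/setP=> x; rewrite inE !depth_colouringE negb_exists_in.
have [_ /subsetP sI _] := and3P (chain_interval IK).
apply/andP/idP => [[/forall_inP xK] | xI].
  apply: contraLR => xI; rewrite -ltnNge; apply: depth_lt_rank => // J JK.
  rewrite /leaves (negPf (xK J JK)) orbF => xJ.
  by apply: contra xI => /and3P[/subsetP->].
split.
  apply/forall_inP=> J JK; rewrite negbK.
  have [_ /subsetP sJ _] := and3P (chain_interval JK).
  case/orP: (chain_total IK JK) => /and3P[/subsetP H1 _ /subsetP H2].
    exact/H2/sI.
  exact/sJ/H1.
by apply: rank_le_depth => J JK /and3P[/subsetP H1 _ _]; rewrite /leaves H1.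
Qed.

Lemma upper_end_depth I : I \in K ->
  upper_end (depth_colouring K) (chain_rank K I) = I.2.
Proof.
move=> IK; apply/setP=> x; rewrite inE !depth_colouringE.
have [_ /subsetP sI _] := and3P (chain_interval IK).
apply/negP/idP => [xK | xI /andP[/exists_inP[J0 J0K xJ0]]].
  apply: contraT => xI; case: xK; apply/andP; split; first by apply/exists_inP; exists I.
  apply: rank_le_depth => J JK /and3P[_ _ /subsetP H2].
  by rewrite /leaves (contra (H2 x)) ?orbT.
apply/negP; rewrite -ltnNge; apply: depth_lt_rank => // J JK.
have [_ /subsetP sJ _] := and3P (chain_interval JK).
have [_ /subsetP sJ0 _] := and3P (chain_interval J0K).
rewrite /leaves => /orP[xJ|]; last by apply: contra => /and3P[_ _ /subsetP->].
by case/orP: (chain_total JK J0K) => /and3P[/subsetP H1 _ /subsetP H2];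
   [move: (H2 x (sJ x xJ)) | move: (sJ0 x (H1 x xJ))]; rewrite (negPf xJ0).
Qed.

(** By the two previous lemmas each I in K is the interval of index
    [chain_rank K I], so K is contained in a chain that has at most k = #|K|
    members. *)
Lemma depth_colouringK : level_chain (depth_colouring K) = K.
Proof.
apply/esym/eqP; rewrite eqEcard; apply/andP; split.
  apply/subsetP=> I IK; apply/imsetP; exists (inord (chain_rank K I)).
    by rewrite inE inordK ?chain_rank_gt0 // ltnS chain_rank_le.
  rewrite inordK ?ltnS ?chain_rank_le // lower_end_depth // upper_end_depth //.
  exact: surjective_pairing.
rewrite Kk -[X in (_ <= X)%N]card_ord_gt0.
apply: leq_trans (leq_imset_card _ _) _; apply: subset_leq_card.
by apply/subsetP=> i; rewrite !inE.
Qed.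

(** An unused middle level j would make the intervals of index j and j + 1
    equal, and the chain would have fewer than k members. *)
Lemma depth_colouring_valid : (0 < k)%N -> depth_colouring K \in chain_colourings D.
Proof.
move=> k0; set g := depth_colouring K.
have end_in i : (0 < i <= k)%N -> (lower_end g i, upper_end g i) \in K.
  move=> /andP[i0 ik]; rewrite -depth_colouringK; apply/imsetP.
  by exists (inord i); rewrite ?inE inordK.
have kk : (0 < k <= k)%N by rewrite k0 /=.
have /and3P[/set0Pn[x xl] _ kD] := chain_interval (end_in k kk).
rewrite inE -upper_endE kD andbT; apply/andP; split.
  apply/forallP=> y; apply/negP=> /eqP gy.
  have [dE sE] := depth_colouringE y; move: dE sE; rewrite -/g gy /=.
  move=> dE /esym/exists_inP[I IK yI].
  have : I \in [set I in K | leaves I y] by rewrite inE IK /leaves yI orbT.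
  by rewrite (cards0_eq (esym dE)) inE.
apply/andP; split.
  apply/existsP; exists x; move: xl; rewrite inE => /andP[].
  case: (g x) => b i /= /negPf -> ki; rewrite xpair_eqE -val_eqE /= eqn_leq ki.
  by rewrite -[(i <= k)%N]ltnS ltn_ord.
apply/forall_inP=> j; rewrite inE => /andP[j0 jk]; apply: contraT => /existsPn gj.
have lvl x' : (j <= (g x').2)%N = (j.+1 <= (g x').2)%N.
  by rewrite [RHS]ltn_neqAle (eq_sym (j : nat)) (val_eqE (g x').2 j) (gj x').
have inj : {in [set i : 'I_k.+1 | (0 < i)%N] &, injective (fun i : 'I_k.+1 => (lower_end g i, upper_end g i))}.
  apply/imset_injP; rewrite -/(level_chain g) depth_colouringK Kk.
  by rewrite card_ord_gt0.
have := inj j (inord j.+1); rewrite !inE inordK // j0 => /(_ isT isT).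
have -> : lower_end g j = lower_end g j.+1 by apply/setP=> y; rewrite !inE lvl.
have -> : upper_end g j = upper_end g j.+1 by apply/setP=> y; rewrite !inE lvl.
by move=> /(_ erefl) /(congr1 val) /=; rewrite inordK // => /n_Sn.
Qed.
End ChainInInt.

Lemma card_Int_faces D : is_complex D -> (0 < k)%N ->
  #|[set K in Int D | #|K| == k]| = #|chain_colourings D|.
Proof.
move=> cD k0.
have -> : [set K in Int D | #|K| == k] = [set level_chain g | g in chain_colourings D].
  apply/setP=> K; rewrite inE; apply/andP/imsetP => [[KD /eqP Kk] | [g gD ->]].
    exists (depth_colouring K); first exact: depth_colouring_valid.
    by rewrite (depth_colouringK KD).
  by rewrite level_chain_Int //= (card_level_chain gD).
apply: card_in_imset => g g' gD gD' E.
by rewrite -(level_chainK gD) E (level_chainK gD').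
Qed.

(** The face B_k at the top of the chain coded by g. *)
Definition top_face g : {set T} := [set x | g x != (true, ord_max)].

Definition top_face_colours (B : {set T}) (x : T) : {set colour k} :=
  if x \in B then ~: [set (true, ord0); (true, ord_max)] else [set (true, ord_max)].

Lemma chain_colourings_top_face D (B : {set T}) : (0 < k)%N -> B \in D ->
  [set g in chain_colourings D | top_face g == B] =
  [set g in colourings (top_face_colours B) | onto g].
Proof.
move=> k0 BD; apply/setP=> g; rewrite !inE -/(top_face g).
apply/idP/idP => [/andP[/and3P[/forallP g0 -> gD] /eqP <-] | /andP[/forallP gB ->]].
  rewrite andbT; apply/forallP=> x; rewrite /top_face_colours inE.
  by case: ifPn => gx; rewrite !inE ?negb_or ?g0 ?gx // -[_ == _]negbK.
have -> : top_face g = B.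
  apply/setP=> x; have := gB x; rewrite /top_face_colours inE.
  by case: ifP => _; rewrite !inE ?negb_or; [case/andP | move=> ->].
rewrite BD eqxx !andbT; apply/forallP=> x; have := gB x; rewrite /top_face_colours.
case: ifP => _; rewrite !inE ?negb_or; first by case/andP.
by move=> /eqP ->; rewrite xpair_eqE -val_eqE /= -lt0n.
Qed.

Lemma FentryE l : (0 < k)%N -> Fentry k l =
  \sum_(j < k) (-1) ^+ j * 'C(k.-1, j)%:Z *
     ((2 * k%:Z - 2 * j%:Z) ^+ l - (2 * k%:Z - 2 * j%:Z - 1) ^+ l).
Proof. by rewrite /Fentry; case: k. Qed.

Lemma card_face_colours : (0 < k)%N ->
  #|~: [set ((true, ord0) : colour k); (true, ord_max)]|%:Z = 2 * k%:Z.
Proof.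
move=> k0; rewrite cardsCs setCK cards2 card_prod card_bool card_ord.
by rewrite xpair_eqE -val_eqE /= neq_ltn k0 /=; lia.
Qed.

Lemma card_chain_colourings D : (0 < k)%N ->
  #|chain_colourings D|%:Z = \sum_(B in D) Fentry k #|B|.
Proof.
move=> k0; rewrite -sum1_card (partition_big top_face (mem D)) /=; last first.
  by move=> g; rewrite inE => /and3P[].
rewrite -natz natr_sum; apply: eq_bigr => B BD.
transitivity (#|[set g in chain_colourings D | top_face g == B]|%:Z).
  by rewrite natz -sum1_card; congr (Posz _); apply: eq_bigl => g; rewrite inE.
rewrite chain_colourings_top_face // (card_onto (P := B)) //.
- rewrite FentryE //; apply: eq_bigr => j _; congr (_ * (_ - _)).
    by rewrite -prodr_const; apply: eq_bigr => x xB; rewrite /top_face_colours xB card_face_colours.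
  by rewrite -prodr_const; apply: eq_bigr => x xB; rewrite /top_face_colours xB card_face_colours.
- move=> x xB; rewrite /top_face_colours xB !inE /= ; split=> // -[b i].
  rewrite !inE /= => /andP[i0 ik]; rewrite !xpair_eqE -!val_eqE /=; lia.
- move=> x; rewrite /top_face_colours inE => /negPf ->; exists (true, ord_max).
  by rewrite !inE ltnn andbF.
Qed.
End Chains.

(** * The f-vector and the dimension of the interval subdivision *)

(** All the levels from 1 to k are used on the top face, so a chain of size k
    needs a face with k points at least; this bounds the dimension of Int D. *)
Lemma chain_colouring_top_face_ge (T : finType) (k : nat) (D : {set {set T}}) (g : {ffun T -> colour k}) :
  g \in chain_colourings k D -> (k <= #|top_face g|)%N.
Proof.
rewrite inE => /and3P[_ /andP[/existsP[t /eqP gt] /forall_inP gM] _].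
rewrite -[X in (X <= _)%N]card_ord_gt0.
apply: leq_trans (leq_imset_card (fun x => (g x).2) _).
apply: subset_leq_card; apply/subsetP=> i; rewrite inE => i0; apply/imsetP.
have [->|ik] := eqVneq i ord_max.
  by exists t; rewrite ?inE gt.
have /existsP[x /eqP gx] : [exists x, (g x).2 == i].
  apply: gM; rewrite inE i0 /=; have := ltn_ord i; move: ik; rewrite -val_eqE /=; lia.
exists x; rewrite ?gx // inE; apply: contra ik => /eqP gxE.
by rewrite -gx gxE.
Qed.

(** Ordering the points of B as x_1, ..., x_k and giving x_j the colour
    (false, j) codes a maximal chain under B. *)
Lemma chain_colourings_nonempty (T : finType) (k : nat) (D : {set {set T}}) (B : {set T}) :
  (0 < k)%N -> B \in D -> #|B| = k -> exists g, g \in chain_colourings k D.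
Proof.
move=> k0 BD Bk.
pose g := [ffun x => if x \in B then (false, inord (index x (enum B)).+1)
                     else (true, ord_max)] : {ffun T -> colour k}.
have hit i : (0 < i <= k)%N -> exists x, g x = (false, inord i).
  case/andP=> i0 ik; have /card_gt0P[x0 _] : (0 < #|B|)%N by rewrite Bk.
  have iB : (i.-1 < size (enum B))%N by rewrite -cardE Bk prednK.
  exists (nth x0 (enum B) i.-1); rewrite ffunE -mem_enum mem_nth //.
  by rewrite index_uniq ?enum_uniq // prednK.
exists g; rewrite inE; apply/and3P; split.
- apply/forallP=> x; rewrite ffunE; case: ifP => // _.
  by rewrite xpair_eqE -val_eqE /= -lt0n.
- apply/andP; split.
    apply/existsP; have [|x gx] := hit k; first by rewrite k0 leqnn.
    by exists x; rewrite gx xpair_eqE -val_eqE /= inordK.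
  apply/forall_inP=> i; rewrite inE => /andP[i0 ik].
  have [|x gx] := hit i; first by rewrite i0 ltnW.
  by apply/existsP; exists x; rewrite gx -val_eqE /= inordK // ltnS ltnW.
- suff -> : [set x | g x != (true, ord_max)] = B by [].
  by apply/setP=> x; rewrite inE ffunE; case: ifP; rewrite ?eqxx.
Qed.

Lemma dim_succ_Int (T : finType) (D : {set {set T}}) :
  is_complex D -> dim_succ (Int D) = dim_succ D.
Proof.
move=> cD; apply/eqP; rewrite eqn_leq; apply/andP; split.
  apply/bigmax_leqP=> K KD; case: (posnP #|K|) => [-> // | K0].
  have gD := depth_colouring_valid KD (erefl _) K0.
  apply: leq_trans (chain_colouring_top_face_ge gD) _.
  apply: (leq_bigmax_cond (F := fun B : {set T} => #|B|)).
  by move: gD; rewrite inE => /and3P[].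
apply/bigmax_leqP=> B BD; case: (posnP #|B|) => [-> // | B0].
have [g gD] := chain_colourings_nonempty B0 BD (erefl _).
rewrite -{1}(card_level_chain gD).
exact: (leq_bigmax_cond (F := fun K : {set _} => #|K|) _ (level_chain_Int cD gD)).
Qed.

Lemma fnum0 (T : finType) (D : {set {set T}}) : set0 \in D -> fnum D 0 = 1%N.
Proof.
move=> D0; rewrite /fnum -(cards1 (set0 : {set T})); apply: eq_card => A.
by rewrite !inE cards_eq0; case: eqP => [->|]; rewrite ?D0 ?andbF.
Qed.

Lemma sum_faces_card (T : finType) (D : {set {set T}}) (F : nat -> int) :
  \sum_(B in D) F #|B| = \sum_(l < (dim_succ D).+1) F l * (fnum D l)%:Z.
Proof.
have dimB (B : {set T}) : B \in D -> (#|B| < (dim_succ D).+1)%N.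
  by move=> BD; rewrite ltnS; exact: (leq_bigmax_cond (F := fun B : {set _} => #|B|)).
rewrite (partition_big (fun B : {set T} => inord #|B| : 'I_(dim_succ D).+1) predT) //=.
apply: eq_bigr => l _; rewrite (eq_bigr (fun=> F l)) => [|B /andP[BD /eqP <-]]; last first.
  by rewrite inordK // dimB.
rewrite sumr_const -[LHS]mulr_natr natz; congr (_ * Posz _); apply: eq_card => B.
rewrite unfold_in /= !inE; case BD: (B \in D) => //=.
by rewrite -val_eqE /= inordK // dimB.
Qed.

Lemma fnum_Int (T : finType) (D : {set {set T}}) (k : nat) : is_complex D ->
  (fnum (Int D) k)%:Z = \sum_(l < (dim_succ D).+1) Fentry k l * (fnum D l)%:Z.
Proof.
move=> cD; case: (posnP k) => [-> | k0].
  rewrite big_ord_recl big1 ?addr0 => [|i _]; last by rewrite mul0r.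
  rewrite !fnum0 //; first by case: cD.
  by rewrite inE sub0set; apply/forall_inP=> x; rewrite inE.
rewrite -sum_faces_card -card_chain_colourings //.
by rewrite /fnum (card_Int_faces cD).
Qed.

(** * Cut signed permutations as colourings *)

Section StrictRank.
Variables (T : finType) (lt : rel T).
Hypotheses (lt_irr : irreflexive lt) (lt_trans : transitive lt).
Hypothesis lt_total : forall x y, x != y -> lt x y || lt y x.

Definition strict_rank x := #|[set y | lt y x]|.

Lemma strict_rank_lt x y : lt x y = (strict_rank x < strict_rank y)%N.
Proof.
have mono u v : lt u v -> (strict_rank u < strict_rank v)%N.
  move=> uv; apply: proper_card; apply/properP; split.
    by apply/subsetP=> w; rewrite !inE => /lt_trans; apply.
  by exists u; rewrite inE ?lt_irr.
apply/idP/idP => [/mono // | xy].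
have [xE|/lt_total/orP[//|/mono yx]] := eqVneq x y; first by rewrite xE ltnn in xy.
by have := ltn_trans xy yx; rewrite ltnn.
Qed.

Lemma strict_rank_inj : injective strict_rank.
Proof.
move=> x y e; apply/eqP; apply: contraT => /lt_total.
by rewrite !strict_rank_lt e ltnn.
Qed.

Lemma strict_rank_bound x : (strict_rank x < #|T|)%N.
Proof.
rewrite -cardsT; apply: proper_card; rewrite properE subsetT /=.
by apply/subsetPn; exists x; rewrite ?inE // lt_irr.
Qed.
End StrictRank.

Lemma pm_val_inj m : injective (@pm_val m).
Proof.
move=> [b i] [c j]; rewrite /pm_val /=; case: b c => [] [] /= e;
  by [congr (_, _); apply: val_inj => /=; lia | lia].
Qed.

Section Words.
Variable d : nat.
Local Notation N := d.+1.
Implicit Types (t : {perm pm N}) (S : {set 'I_N}) (p q : 'I_N).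

Lemma sword_nth t p : (sword t)`_p.+1 = pm_val (t (false, p)).
Proof. by rewrite /sword /= (nth_map p) ?size_enum_ord // nth_ord_enum. Qed.

(** A set S of cuts of a word is a set of indices in 'I_d.+1, following the
    convention of [Des_B]: cutting at i separates the entries i and i + 1 of
    [sword].  The letter of position p (from 0) is the entry p + 1 of [sword], so
    its block has the index [cut_count S p]. *)
Definition cut_count S (p : nat) : nat := #|[set i in S | (i <= p)%N]|.

Lemma cut_countS S (p : nat) (pN : (p.+1 < N)%N) :
  cut_count S p.+1 = ((Ordinal pN \in S) + cut_count S p)%N.
Proof.
rewrite /cut_count (cardsD1 (Ordinal pN)) inE leqnn andbT; congr (_ + _)%N.
apply: eq_card => i; rewrite !inE -val_eqE /=; case: (i \in S); rewrite ?andbF //=; lia.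
Qed.

Lemma cut_count0 S : cut_count S 0 = (ord0 \in S).
Proof.
rewrite /cut_count (cardsD1 ord0) inE /= andbT -[RHS]addn0; congr (_ + _)%N.
by apply: eq_card0 => i; rewrite !inE leqn0 -val_eqE /=; case: (_ == 0)%N; rewrite ?andbF.
Qed.

Lemma cut_count_full S : cut_count S d = #|S|.
Proof. by apply: eq_card => i; rewrite !inE -ltnS ltn_ord andbT. Qed.

Lemma cut_count_le S p q : (p <= q)%N -> (cut_count S p <= cut_count S q)%N.
Proof.
move=> pq; apply: subset_leq_card; apply/subsetP=> i.
by rewrite !inE => /andP[-> /leq_trans->].
Qed.

Lemma cut_count_inj S S' : (forall p, cut_count S p = cut_count S' p) -> S = S'.
Proof.
move=> e; apply/setP=> -[[|i] iN].
  have := e ord0; rewrite !cut_count0 /=.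
  have -> : Ordinal iN = ord0 by apply: val_inj.
  by do 2!case: (_ \in _).
have := e (Ordinal iN); rewrite /= !cut_countS (e (Ordinal (ltnW iN))) => /addIn.
by do 2!case: (_ \in _).
Qed.

Section Bijection.
Variables (k : nat) (s : 'I_N).
Implicit Types (g : {ffun 'I_N -> colour k}) (x : {perm pm N} * {set 'I_N}).

(** The index 0 is excluded from the cuts; it is never a descent since the
    first letter s + 1 is positive. *)
Definition cut_perms : {set {perm pm N} * {set 'I_N}} :=
  [set x : {perm pm N} * {set 'I_N} |
    [&& x.1 \in signed_perms N, (sword x.1)`_1 == s.+1%:Z, 0 < (sword x.1)`_N,
        Des_B x.1 \subset x.2, #|x.2| == k & ord0 \notin x.2]].

(** The colours open to the value v.+1 in a word whose first block increases
    from s.+1. *)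
Definition word_colours (v : 'I_N) : {set colour k} :=
  if (v < s)%N then [set c | c.2 != ord0]
  else if v == s then [set (false, ord0)] else ~: [set (true, ord0)].

Definition word_colouring x : {ffun 'I_N -> colour k} :=
  [ffun v => let y := (x.1^-1)%g (false, v) in (y.1, inord (cut_count x.2 y.2))].

Definition signed_value g v : int := pm_val ((g v).1, v).

(** The order in which the values occur in the word with colouring g. *)
Definition word_lt g u v : bool :=
  ((g u).2 < (g v).2)%N || ((g u).2 == (g v).2) && (signed_value g u < signed_value g v).

Lemma word_lt_irr g : irreflexive (word_lt g).
Proof. by move=> u; rewrite /word_lt ltnn ltxx andbF. Qed.

Lemma word_lt_trans g : transitive (word_lt g).
Proof.
move=> v u w; rewrite /word_lt => /orP[uv|/andP[/eqP -> uv]] /orP[vw|/andP[/eqP <- vw]].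
- by rewrite (ltn_trans uv vw).
- by rewrite uv.
- by rewrite vw.
- by rewrite eqxx (lt_trans uv vw) orbT.
Qed.

Lemma word_lt_total g u v : u != v -> word_lt g u v || word_lt g v u.
Proof.
move=> uv; rewrite /word_lt; case: ltngtP => [_|_|/ord_inj ->]; rewrite ?orbT // eqxx /=.
by rewrite -neq_lt; apply: contra uv => /eqP/pm_val_inj[_ ->].
Qed.

Local Notation rank g := (strict_rank (word_lt g)).

Lemma rank_lt g u v : word_lt g u v = (rank g u < rank g v)%N.
Proof. exact: strict_rank_lt (@word_lt_irr g) (@word_lt_trans g) (@word_lt_total g) u v. Qed.

Lemma rank_inj g : injective (rank g).
Proof. exact: strict_rank_inj (@word_lt_irr g) (@word_lt_trans g) (@word_lt_total g). Qed.

Lemma rank_bound g v : (rank g v < N)%N.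
Proof. by rewrite -[X in (_ < X)%N](card_ord N); exact: strict_rank_bound (@word_lt_irr g) v. Qed.

Section Reading.
Variables (t : {perm pm N}) (S : {set 'I_N}).
Hypothesis tS : (t, S) \in cut_perms.
Let g := word_colouring (t, S).

Lemma cut_signed y : t (pm_opp y) = pm_opp (t y).
Proof. by move: tS; rewrite inE => /and5P[]; rewrite inE => /forallP/(_ y)/eqP. Qed.
Lemma cut_first : (sword t)`_1 = s.+1%:Z.
Proof. by move: tS; rewrite inE => /and5P[_ /eqP]. Qed.
Lemma cut_last : 0 < (sword t)`_N.
Proof. by move: tS; rewrite inE => /and5P[]. Qed.
Lemma cut_des : Des_B t \subset S.
Proof. by move: tS; rewrite inE => /and5P[]. Qed.
Lemma cut_card : #|S| = k.
Proof. by move: tS; rewrite inE => /and5P[_ _ _ _ /andP[/eqP]]. Qed.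
Lemma cut_ord0 : ord0 \notin S.
Proof. by move: tS; rewrite inE => /and5P[_ _ _ _ /andP[_]]. Qed.

Let letter p : 'I_N := (t (false, p)).2.

Lemma cut_count_bound p : (cut_count S p <= k)%N.
Proof.
rewrite -cut_card -cut_count_full; apply: (@cut_count_le S p ord_max).
by rewrite /= -ltnS.
Qed.

(** The value of the letter of position p has that position under the inverse
    permutation, with the sign of the letter. *)
Lemma letter_inv p : (t^-1)%g (false, letter p) = ((t (false, p)).1, p).
Proof.
apply: (@perm_inj _ t); rewrite permKV /letter.
case E: (t (false, p)) => [[] v] //=.
by have := cut_signed (false, p); rewrite E /pm_opp /= => ->.
Qed.

Lemma letter_inj : injective letter.
Proof.
move=> p q e; have := letter_inv p; rewrite e letter_inv.
by case.
Qed.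

Lemma letter_colour p : g (letter p) = ((t (false, p)).1, inord (cut_count S p)).
Proof. by rewrite ffunE /= letter_inv. Qed.

Lemma letter_level p : (g (letter p)).2 = cut_count S p :> nat.
Proof. by rewrite letter_colour /= inordK // ltnS cut_count_bound. Qed.

Lemma letter_value p : signed_value g (letter p) = (sword t)`_p.+1.
Proof.
by rewrite sword_nth /signed_value letter_colour /letter -surjective_pairing.
Qed.

Lemma sword_step (p : nat) (pN : (p.+1 < N)%N) : Ordinal pN \notin S ->
  (sword t)`_p.+1 < (sword t)`_p.+2.
Proof.
move=> pS; have : Ordinal pN \notin Des_B t by apply: contra pS; apply/subsetP/cut_des.
rewrite inE /= -leNgt le_eqVlt => /orP[/eqP|//].
have e := sword_nth t (Ordinal pN); have e' := sword_nth t (Ordinal (ltnW pN)).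
rewrite /= in e e'; rewrite e e' => /pm_val_inj/perm_inj [] /=.
by move/eqP; rewrite -[_ == _]/(p == p.+1)%N => /eqP /n_Sn.
Qed.

(** Blocks are increasing and follow each other in the order of their index. *)
Lemma letter_lt p q : (p < q)%N -> word_lt g (letter p) (letter q).
Proof.
move=> pq; rewrite /word_lt !letter_value -val_eqE /= !letter_level.
case: q pq => q qN /= pq.
elim: q qN pq => // q IHq qN; rewrite ltnS leq_eqVlt => /orP[/eqP pq | pq].
  rewrite cut_countS pq; case: (boolP (_ \in S)) => qS; first by rewrite add1n ltnSn.
  by rewrite add0n ltnn eqxx /= sword_step.
have := IHq (ltnW qN) pq; rewrite cut_countS.
case: (boolP (_ \in S)) => qS; first by move=> H; rewrite add1n ltnS leq_eqVlt; lia.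
rewrite add0n => /orP[->//|/andP[-> H]]; apply/orP; right => /=.
exact: lt_trans H (sword_step qS).
Qed.

Lemma letter_onto v : exists p, v = letter p.
Proof. by have [f fK Kf] := injF_bij letter_inj; exists (f v); rewrite Kf. Qed.

(** The position of a letter can be read off the colouring alone; this is what
    makes [word_colouring] injective. *)
Lemma letter_rank p : rank g (letter p) = p.
Proof.
rewrite -[RHS](@card_ord_lt N) ?(ltnW (ltn_ord p)) //.
rewrite -(card_imset _ letter_inj); apply: eq_card => v.
have [q ->] := letter_onto v; rewrite inE (mem_imset _ _ letter_inj) inE.
case: (ltngtP q p) => [/letter_lt -> // | pq | /ord_inj ->].
  by apply/negP=> /word_lt_trans/(_ (letter_lt pq)); rewrite word_lt_irr.
exact: word_lt_irr.
Qed.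

(** There is no cut, hence no descent, inside the first block. *)
Lemma first_block p : cut_count S p = 0%N -> s.+1%:Z <= (sword t)`_p.+1.
Proof.
case: p => p pN; change (cut_count S p = 0%N -> s.+1%:Z <= (sword t)`_p.+1).
elim: p pN => [|p IHp] pN; first by rewrite cut_first.
rewrite cut_countS => /eqP; rewrite addn_eq0 => /andP[pS /eqP p0].
apply: le_trans (IHp (ltnW pN) p0) _; apply/ltW/sword_step.
by move: pS; case: (_ \in S).
Qed.

(** The block index starts at 0, ends at k and increases by at most 1. *)
Lemma cut_count_hits (j : nat) : (j <= k)%N -> exists p : 'I_N, cut_count S p = j.
Proof.
have hit m : (m < N)%N -> (j <= cut_count S m)%N -> exists p : 'I_N, cut_count S p = j.
  elim: m => [|m IHm] mN.
    rewrite cut_count0 (negPf cut_ord0) leqn0 => /eqP ->.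
    by exists ord0; rewrite cut_count0 (negPf cut_ord0).
  rewrite leq_eqVlt => /orP[/eqP -> | ]; first by exists (Ordinal mN).
  rewrite cut_countS => H; apply: IHm (ltnW mN) _.
  by move: H; case: (_ \in S); rewrite ?add1n ?ltnS ?add0n // => /ltnW.
by move=> jk; apply: (hit d); rewrite ?ltnSn // cut_count_full cut_card.
Qed.

Lemma word_colouring_valid : g \in [set g in colourings word_colours | onto g].
Proof.
rewrite !inE; apply/and3P; split.
- apply/forallP=> v; have [p ->] := letter_onto v.
  have first : cut_count S p = 0%N -> (t (false, p)).1 = false /\ (s <= letter p)%N.
    move=> /first_block; rewrite sword_nth /letter /pm_val; case: (t _) => [[] w] /=; lia.
  rewrite /word_colours; case: ltngtP => [ps | sp | /ord_inj e].
  - rewrite inE -val_eqE /= letter_level; apply/eqP=> /first[] // _.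
    by rewrite leqNgt ps.
  - rewrite -val_eqE /= gtn_eqF // !inE; apply/eqP=> gp.
    have := letter_level p; rewrite gp => /esym/first[] //.
    by have := letter_colour p; rewrite gp => -[<-].
  have p0 : p = ord0.
    have := cut_first; rewrite (sword_nth _ ord0) => v0.
    apply: letter_inj; rewrite e /letter; move: v0; rewrite /pm_val.
    by case: (t _) => [[] w] /= v0; [lia | apply: ord_inj => /=; lia].
  rewrite -val_eqE /= e eqxx inE; apply/eqP.
  have tp : (t (false, p)).1 = false.
    have := cut_first; rewrite (sword_nth _ ord0) p0 /pm_val.
    by case: (t _) => [[] w] //=; lia.
  have cp : cut_count S p = 0%N by rewrite p0 cut_count0 (negPf cut_ord0).
  rewrite -e letter_colour tp cp; congr (_, _); apply: ord_inj.
  by rewrite inordK.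
- apply/existsP; exists (letter ord_max); rewrite letter_colour cut_count_full cut_card.
  rewrite xpair_eqE -val_eqE /= inordK // eqxx andbT.
  have := cut_last; rewrite (sword_nth _ ord_max) /pm_val.
  by case: (t _).1 => //=; lia.
- apply/forall_inP=> j _; have [|p jp] := @cut_count_hits j; first by rewrite -ltnS.
  by apply/existsP; exists (letter p); rewrite -val_eqE /= letter_level jp.
Qed.
End Reading.

(** The colouring determines the position and the sign of every value, and the
    block index of every position, hence the word and the cuts. *)
Lemma word_colouring_inj : {in cut_perms &, injective word_colouring}.
Proof.
move=> [t S] [t' S'] xP xP' e.
have same p : (t (false, p)).2 = (t' (false, p)).2.
  have [q qE] := letter_onto xP (t' (false, p)).2.
  have := letter_rank xP' p; rewrite -e qE (letter_rank xP) => /ord_inj qp.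
  by rewrite qp.
have gap_eq p : cut_count S p = cut_count S' p.
  by rewrite -(letter_level xP p) -(letter_level xP' p) same e.
have tt' p : t (false, p) = t' (false, p).
  rewrite [LHS]surjective_pairing [RHS]surjective_pairing same; congr (_, _).
  by have := letter_colour xP p; rewrite same e (letter_colour xP') => -[].
congr (_, _); last exact: cut_count_inj.
apply/permP=> -[[] p]; last exact: tt'.
have := cut_signed xP (false, p); rewrite {1}/pm_opp /= => ->.
have := cut_signed xP' (false, p); rewrite {1}/pm_opp /= => ->.
by rewrite tt'.
Qed.

Section Sorting.
Variable g : {ffun 'I_N -> colour k}.
Hypothesis gQ : g \in [set g in colourings word_colours | onto g].

Let place v : 'I_N := Ordinal (rank_bound g v).
Lemma place_inj : injective place.
Proof. by move=> u v /(congr1 val) /rank_inj. Qed.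
Definition letter_at : 'I_N -> 'I_N := (perm place_inj)^-1%g.

Lemma letter_atK p : rank g (letter_at p) = p.
Proof.
by have := permKV (perm place_inj) p; rewrite permE => /(congr1 val).
Qed.

Lemma placeK v : letter_at (place v) = v.
Proof. by rewrite /letter_at -(permE place_inj) permK. Qed.

Lemma letter_at_lt p q : word_lt g (letter_at p) (letter_at q) = (p < q)%N.
Proof. by rewrite rank_lt !letter_atK. Qed.

(** The inverse of the signed permutation to be built: a value goes to its
    rank, with the sign prescribed by its colour. *)
Definition position (y : pm N) : pm N := (y.1 (+) (g y.2).1, place y.2).
Lemma position_inj : injective position.
Proof.
move=> [b u] [c v] [/=] e /rank_inj uv; move: e; rewrite uv => /addIb ->.
by [].
Qed.
Definition sorted_perm : {perm pm N} := (perm position_inj)^-1%g.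

Definition level_rises : {set 'I_N} :=
  [set p : 'I_N | (0 < p)%N && ((g (letter_at (inord p.-1))).2 < (g (letter_at p)).2)%N].

Lemma sorted_permE p : sorted_perm (false, p) = ((g (letter_at p)).1, letter_at p).
Proof.
apply: (@perm_inj _ (perm position_inj)); rewrite permKV permE /position /= addbb.
by congr (_, _); apply: ord_inj; rewrite /= letter_atK.
Qed.

Lemma sorted_perm_signed : sorted_perm \in signed_perms N.
Proof.
rewrite inE; apply/forallP=> y; apply/eqP; apply: (@perm_inj _ (perm position_inj)).
rewrite permKV permE /position /=.
have := permKV (perm position_inj) y; rewrite permE -/sorted_perm.
by case: (sorted_perm y) => b v <- /=; rewrite addNb.
Qed.

Lemma sorted_word p : (sword sorted_perm)`_p.+1 = signed_value g (letter_at p).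
Proof. by rewrite sword_nth sorted_permE. Qed.

Lemma colour_allowed v : g v \in word_colours v.
Proof. by move: gQ; rewrite !inE => /andP[/forallP]. Qed.

Lemma colour_s : g s = (false, ord0).
Proof. by have := colour_allowed s; rewrite /word_colours ltnn eqxx inE => /eqP. Qed.

Lemma level_le p q : (p <= q)%N -> ((g (letter_at p)).2 <= (g (letter_at q)).2)%N.
Proof.
rewrite leq_eqVlt => /orP[/eqP/ord_inj -> // |].
by rewrite -letter_at_lt => /orP[/ltnW|/andP[/eqP ->]].
Qed.

(** The value s is the smallest of level 0: smaller values do not have level 0,
    and no value has the colour (true, 0). *)
Lemma letter_at0 : letter_at ord0 = s.
Proof.
apply: (@rank_inj g); rewrite letter_atK; apply/esym/eqP; rewrite cards_eq0.
apply/eqP/setP=> u; rewrite !inE; apply/negP; rewrite /word_lt colour_s ltn0 /=.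
move=> /andP[/eqP u0]; rewrite /signed_value colour_s.
have := colour_allowed u; rewrite /word_colours; case: ltngtP => [us | su | /ord_inj ->].
- by rewrite inE u0 eqxx.
- rewrite -val_eqE /= gtn_eqF // !inE; move: u0; case: (g u) => b i /= ->.
  by rewrite xpair_eqE eqxx andbT /pm_val /=; case: b => //= _; lia.
- by rewrite colour_s ltxx.
Qed.

Lemma onto_level (j : 'I_k.+1) : exists v, (g v).2 = j.
Proof.
move: gQ; rewrite inE => /and3P[_ /existsP[w /eqP gw] /forall_inP gM].
case: (posnP j) => [j0 | j0].
  by exists s; rewrite colour_s; apply: ord_inj.
have [jk | kj] := ltnP j k.
  by have /existsP[v /eqP gv] := gM j ltac:(by rewrite inE j0); exists v.
exists w; rewrite gw; apply: ord_inj => /=; apply/eqP; by rewrite eqn_leq kj -ltnS ltn_ord.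
Qed.

(** The levels along the sorted word start at 0, and they rise by at most 1 at
    each step because every level is used. *)
Lemma cut_count_rises p : cut_count level_rises p = (g (letter_at p)).2.
Proof.
case: p => p pN; change (cut_count level_rises p = (g (letter_at (Ordinal pN))).2).
elim: p pN => [|p IHp] pN.
  rewrite cut_count0 inE ltnn /=.
  have -> : Ordinal pN = ord0 by apply: ord_inj.
  by rewrite letter_at0 colour_s.
rewrite cut_countS (IHp (ltnW pN)) inE /=.
have -> : inord p = Ordinal (ltnW pN) by apply: ord_inj; rewrite inordK // ltnW.
set u := letter_at _; set v := letter_at _.
have uv : ((g u).2 <= (g v).2)%N by apply: level_le => /=.
have step : ((g v).2 <= (g u).2.+1)%N.
  rewrite leqNgt; apply/negP=> H.
  have jk : ((g u).2.+1 < k.+1)%N by exact: ltn_trans H (ltn_ord _).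
  (* A value of the skipped level would stand strictly between two
     consecutive letters. *)
  have [w gw] := onto_level (Ordinal jk).
  have uw : word_lt g u w by rewrite /word_lt gw /= ltnSn.
  have wv : word_lt g w v by rewrite /word_lt gw /= H.
  by move: uw wv; rewrite !rank_lt !letter_atK /=; lia.
by case: (ltngtP (g u).2 (g v).2) uv step => //= H _; lia.
Qed.

(** The value coloured (false, k) is positive and the last letter is not below
    it in the order [word_lt]. *)
Lemma last_letter :
  (g (letter_at ord_max)).2 = k :> nat /\ 0 < signed_value g (letter_at ord_max).
Proof.
move: (gQ); rewrite inE => /and3P[_ /existsP[w /eqP gw] _].
have w0 : 0 < signed_value g w by rewrite /signed_value gw /pm_val /=; lia.
have [<- | wd] := eqVneq w (letter_at ord_max); first by rewrite gw.
have : word_lt g w (letter_at ord_max).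
  have := word_lt_total g wd; rewrite !rank_lt letter_atK /=.
  by have := rank_bound g w; lia.
rewrite /word_lt gw /= => /orP[H | /andP[/eqP <- /(lt_trans w0)]] //.
by have := ltn_ord (g (letter_at ord_max)).2; rewrite ltnS leqNgt H.
Qed.

Lemma sorted_valid : (sorted_perm, level_rises) \in cut_perms.
Proof.
rewrite inE; apply/and5P; split; first exact: sorted_perm_signed.
- change ((sword sorted_perm)`_1 == s.+1%:Z).
  by rewrite (sorted_word ord0) letter_at0 /signed_value colour_s /pm_val /= mul1r.
- change (0 < (sword sorted_perm)`_N).
  by rewrite (sorted_word ord_max); case: last_letter.
- apply/subsetP=> -[[|p] pN]; rewrite !inE.
    by rewrite (sorted_word ord0) letter_at0 /signed_value colour_s /pm_val /=; lia.
  have pN' : (p < N)%N by apply: ltnW.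
  rewrite (sorted_word (Ordinal pN)) (sorted_word (Ordinal pN')) /=.
  have -> : inord p = Ordinal pN' by apply: ord_inj; rewrite inordK.
  move=> des; have : word_lt g (letter_at (Ordinal pN')) (letter_at (Ordinal pN)).
    by rewrite letter_at_lt /=.
  by case/orP=> // /andP[_ /(lt_trans des)]; rewrite ltxx.
apply/andP; split; last by rewrite inE.
by rewrite -cut_count_full (cut_count_rises ord_max); case: last_letter => ->.
Qed.

Lemma sortedK : word_colouring (sorted_perm, level_rises) = g.
Proof.
apply/ffunP=> v; rewrite ffunE /= invgK permE /position /=.
rewrite (cut_count_rises (place v)) placeK inord_val; exact/esym/surjective_pairing.
Qed.
End Sorting.

Lemma card_cut_perms :
  #|cut_perms| = #|[set g in colourings word_colours | onto g]|.
Proof.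
rewrite -(card_in_imset word_colouring_inj); apply: eq_card => g.
apply/imsetP/idP => [[[t S] xP ->] | gQ]; first exact: word_colouring_valid.
by exists (sorted_perm g, level_rises g); [exact: sorted_valid | rewrite sortedK].
Qed.

End Bijection.
End Words.

(** * The matrix identity *)

Definition Hinv_entry (d i j : nat) : int := if (j <= i)%N then 'C(d - j, i - j)%:Z else 0.
Definition Hinv_mx (d : nat) : 'M[int]_d.+1 := \matrix_(i < d.+1, j < d.+1) Hinv_entry d i j.

(** The l-th column of the inverse of H_d is a row of binomial coefficients
    shifted by l, so its generating polynomial comes from the binomial theorem. *)
Lemma sum_Hinv_entry_homogeneous (R : comNzRingType) (d l : nat) (a b : R) : (l <= d)%N ->
  \sum_(j < d.+1) (Hinv_entry d j l)%:~R * a ^+ j * b ^+ (d - j) = a ^+ l * (a + b) ^+ (d - l).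
Proof.
move=> ld; rewrite -(big_mkord predT (fun j => (Hinv_entry d j l)%:~R * a ^+ j * b ^+ (d - j))).
rewrite (@big_cat_nat _ _ _ l) ?leqW //= big_nat big1 ?add0r => [|j /andP[_ jl]]; last first.
  by rewrite /Hinv_entry leqNgt jl !mul0r.
rewrite -{1}[l]add0n big_addn subSn // big_mkord addrC exprDn mulr_sumr.
apply: eq_bigr => j _; have jd : (j <= d - l)%N by rewrite -ltnS.
rewrite /Hinv_entry leq_addl addnK exprD -mulr_natr (_ : (d - (j + l) = d - l - j)%N); last lia.
by rewrite -pmulrn; ring.
Qed.

(** The j-th column of H_d has the generating polynomial X^j (1 - X)^(d - j).
    Hence the l-th column of the product has the one obtained by substituting
    a = X and b = 1 - X in a^l (a + b)^(d - l), namely X^l. *)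
Lemma Hmx_Hinv_mx d : Hmx d *m Hinv_mx d = 1%:M.
Proof.
apply/matrixP=> i l; rewrite [LHS]mxE [RHS]mxE.
have ld : (l <= d)%N by rewrite -ltnS.
have polyCz (x : int) : x%:P = x%:~R :> {poly int} by rewrite -[x in LHS]intz rmorph_int.
pose c (i : 'I_d.+1) : int := \sum_j Hmx d i j * Hinv_mx d j l; rewrite -/(c i).
have Hcol (j : 'I_d.+1) : \sum_(i < d.+1) (Hmx d i j)%:P * 'X^i = 'X^j * (1 - 'X) ^+ (d - j) :> {poly int}.
  have jd : (j <= d)%N by rewrite -ltnS.
  have := @sum_Hinv_entry_homogeneous {poly int} d j (- 'X) 1 jd.
  move=> /(congr1 (fun p => (-1) ^+ j * p)).
  rewrite mulr_sumr => E.
  transitivity ((-1) ^+ j * ((- 'X) ^+ j * (- 'X + 1) ^+ (d - j)) : {poly int}).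
    rewrite -E; apply: eq_bigr => i' _.
    have -> : Hmx d i' j = (-1) ^+ (i' + j) * Hinv_entry d i' j.
      by rewrite mxE /Hinv_entry; case: ifP => _; rewrite ?mulr0.
    rewrite polyCz rmorphM rmorphXn rmorphN1 /= expr1n [(- 'X) ^+ i']exprNn exprD.
    by ring.
  by rewrite mulrA [(- 'X) ^+ j]exprNn mulrA -exprMn mulrNN mulr1 expr1n mul1r addrC.
have gen : \sum_(i < d.+1) (c i)%:P * 'X^i = 'X^l :> {poly int}.
  transitivity (\sum_(j < d.+1) (Hinv_entry d j l)%:~R * 'X^j * (1 - 'X) ^+ (d - j) : {poly int}).
    under eq_bigr => i' _ do rewrite rmorph_sum mulr_suml.
    rewrite exchange_big; apply: eq_bigr => j _ /=.
    rewrite -mulrA -Hcol mulr_sumr; apply: eq_bigr => i' _.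
    by rewrite rmorphM /= [Hinv_mx d j l]mxE -polyCz; ring.
  by rewrite sum_Hinv_entry_homogeneous // subrKC expr1n mulr1.
have := congr1 (fun p : {poly int} => p`_i) gen; rewrite coef_sum coefXn.
rewrite (bigD1 i) //= coefCM coefXn eqxx mulr1 big1 ?addr0 => [->|j ji].
  by rewrite val_eqE eq_sym natz.
by rewrite coefCM coefXn eq_sym val_eqE (negPf ji) mulr0.
Qed.

Lemma card_cut_perms0 d (s : 'I_d.+1) : #|cut_perms 0 s| = (s == ord0).
Proof.
rewrite card_cut_perms; case: eqP => [-> | /eqP s0] /=.
  apply: etrans (cards1 [ffun v : 'I_d.+1 => (false, ord0) : colour 0]); apply: eq_card => g.
  rewrite !inE; apply/andP/eqP => [[/forallP gQ _] | ->].
    apply/ffunP=> v; have := gQ v; rewrite ffunE /word_colours ltn0.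
    by case: ifP; rewrite !inE => _; [move/eqP | case: (g v) => -[] i; rewrite (ord1 i)].
  split; last first.
    apply/andP; split; last by apply/forall_inP=> j; rewrite inE ltn0 andbF.
    by apply/existsP; exists ord0; rewrite ffunE xpair_eqE -val_eqE.
  by apply/forallP=> v; rewrite ffunE /word_colours ltn0; case: ifP; rewrite !inE.
apply: eq_card0 => g; rewrite !inE; apply/negP=> /andP[/forallP/(_ ord0)].
by rewrite /word_colours lt0n -val_eqE in s0 *; rewrite s0 inE (ord1 (g ord0).2).
Qed.

Section PermutationSide.
Variables (d k : nat) (s : 'I_d.+1).
Local Notation N := d.+1.

(** A set of k cuts containing the descents is completed by choosing the other
    cuts among the remaining d - des_B t indices other than 0. *)
Lemma card_cuts (t : {perm pm N}) : ord0 \notin Des_B t ->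
  #|[set S : {set 'I_N} | [&& Des_B t \subset S, #|S| == k & ord0 \notin S]]|%:Z =
  Hinv_entry d k (des_B t).
Proof.
rewrite /Hinv_entry /des_B; move: (Des_B t) => De D0; case: leqP => [dk|kd]; last first.
  rewrite (_ : [set S | _] = set0) ?cards0 //; apply/setP=> S; rewrite !inE.
  by apply/and3P=> -[/subset_leq_card tS /eqP Sk _]; move: tS; rewrite Sk leqNgt kd.
pose W := ~: (ord0 |: De).
have W_card : #|W| = (d - #|De|)%N by rewrite /W cardsCs setCK cardsU1 D0 card_ord add1n subSS.
rewrite -W_card -cards_draws; congr (Posz _).
rewrite -[RHS](card_in_imset (f := fun B => B :|: De)) => [|B C]; last first.
  rewrite !inE /W => /andP[/subsetP BW _] /andP[/subsetP CW _] /setP BC.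
  apply/setP=> i; have := BC i; rewrite !inE; have := BW i; have := CW i.
  rewrite !inE !negb_or; case: (i \in De); rewrite ?orbF // andbF.
  by case: (i \in B); case: (i \in C) => // _ /(_ isT).
apply: eq_card => S; rewrite inE; apply/and3P/imsetP => [[tS /eqP Sk S0] | [B]].
  exists (S :\: De).
    rewrite inE cardsD (setIidPr tS) Sk eqxx andbT.
    apply/subsetP=> i; rewrite !inE negb_or => /andP[-> iS]; rewrite andbT.
    by apply: contraNneq S0 => <-.
  by apply/setP=> i; rewrite !inE; have := subsetP tS i; do 2!case: (i \in _) => //=; move=> ->.
rewrite inE => /andP[/subsetP BW /eqP Bk] ->.
have B0 : ord0 \notin B by apply/negP=> /BW; rewrite !inE eqxx.
have BD : [disjoint B & De].
  by rewrite disjoint_subset; apply/subsetP=> i /BW; rewrite !inE negb_or => /andP[].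
split; first exact: subsetUr.
  by rewrite cardsU disjoint_setI0 // cards0 Bk subn0 subnK.
by rewrite inE negb_or B0.
Qed.

Definition Bplus_words (s : 'I_N) : {set {perm pm N}} :=
  [set t in signed_perms N | ((sword t)`_1 == s.+1%:Z) && (0 < (sword t)`_N)].

Lemma Bplus_words_Des t : t \in Bplus_words s -> ord0 \notin Des_B t.
Proof. by rewrite !inE => /and3P[_ /eqP -> _]. Qed.

Lemma des_B_bound t : t \in Bplus_words s -> (des_B t < N)%N.
Proof.
move=> /Bplus_words_Des t0; rewrite /des_B -[X in (_ < X)%N](card_ord N) -cardsT.
by apply: proper_card; rewrite properE subsetT; apply/subsetPn; exists ord0.
Qed.

Lemma sum_Bplus_cut :
  \sum_(r < d.+1) Hinv_entry d k r * (Bplus d.+1 s.+1%:Z r)%:Z = #|cut_perms k s|%:Z.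
Proof.
transitivity (\sum_(t in Bplus_words s) Hinv_entry d k (des_B t)).
  rewrite (partition_big (fun t : {perm pm N} => inord (des_B t) : 'I_N) predT) //=.
  apply: eq_bigr => r _; rewrite (eq_bigr (fun=> Hinv_entry d k r)) => [|t /andP[tB /eqP <-]].
    rewrite sumr_const -[RHS]mulr_natr natz; congr (_ * Posz _).
    rewrite -[RHS]cardsE; apply: eq_card => t; rewrite !inE [RHS]unfold_in /= !inE -!andbA.
    apply/and4P/and4P => -[tp t1 tN tr]; split=> //.
      by rewrite (eqP tr) inord_val.
    by rewrite -(eqP tr) inordK // des_B_bound // !inE tp t1.
  by rewrite inordK // des_B_bound.
rewrite -natz -sum1_card natr_sum (partition_big fst (mem (Bplus_words s))) /=; last first.
  by move=> x; rewrite !inE => /and4P[-> -> -> _].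
apply: eq_bigr => t tB; rewrite -card_cuts ?Bplus_words_Des //.
rewrite -natz -sum1_card natr_sum.
rewrite [RHS](reindex_onto (pair t) snd) => [|[t' S] /andP[_ /eqP /= ->] //].
apply: eq_bigl => S; rewrite /= !inE !eqxx !andbT /=.
by move: tB; rewrite !inE => /and3P[-> -> ->].
Qed.

(** By [card_onto], with the point s of prescribed colour removed, there are s
    values with 2k colours and d - s values with 2k + 1 colours. *)
Lemma sum_cut_words : (0 < k)%N ->
  #|cut_perms k s|%:Z =
  \sum_(j < k) (-1) ^+ j * 'C(k.-1, j)%:Z *
   ((2 * k%:Z - 2 * j%:Z) ^+ s * (2 * k%:Z - 2 * j%:Z + 1) ^+ (d - s)
    - (2 * k%:Z - 2 * j%:Z - 1) ^+ s * (2 * k%:Z - 2 * j%:Z) ^+ (d - s)).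
Proof.
move=> k0; rewrite card_cut_perms (card_onto (P := ~: [set s])) //; first last.
- move=> v; rewrite setCK inE => /eqP ->; exists (false, ord0).
  by rewrite /word_colours ltnn eqxx /top_colour xpair_eqE -val_eqE /= eq_sym -lt0n k0 inE.
- move=> v; rewrite !inE => vs; rewrite /word_colours (negPf vs).
  case: ifP => _; rewrite !inE ?xpair_eqE -!val_eqE /= -?lt0n ?k0; split=> // -[b i].
    by rewrite !inE -val_eqE /= => /andP[i0 _]; rewrite -lt0n.
  by rewrite !inE xpair_eqE -val_eqE /= => /andP[i0 _]; rewrite negb_and -lt0n i0 orbT.
have Qlt (v : 'I_N) : (v < s)%N -> #|word_colours k s v|%:Z = 2 * k%:Z.
  move=> vs; rewrite /word_colours vs.
  have -> : [set c : colour k | c.2 != ord0] = setX setT (~: [set ord0]).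
    by apply/setP=> -[b i]; rewrite !inE.
  by rewrite cardsX cardsT card_bool cardsCs setCK cards1 card_ord; lia.
have Qgt (v : 'I_N) : (s < v)%N -> #|word_colours k s v|%:Z = 2 * k%:Z + 1.
  move=> sv; rewrite /word_colours ltnNge (ltnW sv) -val_eqE /= gtn_eqF //.
  by rewrite cardsCs setCK cards1 card_prod card_bool card_ord; lia.
have prodE (F : int -> int) : \prod_(v in ~: [set s]) F #|word_colours k s v|%:Z =
    F (2 * k%:Z) ^+ s * F (2 * k%:Z + 1) ^+ (d - s).
  rewrite (bigID (fun v : 'I_N => (v < s)%N)) /=; congr (_ * _).
    rewrite (eq_bigr (fun=> F (2 * k%:Z))) => [|v /andP[_ vs]]; last by rewrite Qlt.
    rewrite prodr_const; congr (_ ^+ _).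
    rewrite -[RHS](@card_ord_lt N) ?(ltnW (ltn_ord s)) //; apply: eq_card => v.
    by rewrite [LHS]unfold_in /= !inE -val_eqE /=; lia.
  rewrite (eq_bigr (fun=> F (2 * k%:Z + 1))) => [|v]; last first.
    by rewrite !inE -val_eqE /= => sv; rewrite Qgt //; lia.
  rewrite prodr_const; congr (_ ^+ _).
  have <- : #|~: [set v : 'I_N | (v < s.+1)%N]| = (d - s)%N.
    by rewrite cardsCs setCK card_ord_lt // card_ord subSS.
  by apply: eq_card => v; rewrite [LHS]unfold_in /= !inE -val_eqE /=; lia.
apply: eq_bigr => j _; congr (_ * _).
rewrite (prodE (fun q => q - 2 * j%:Z)) (prodE (fun q => q - 2 * j%:Z - 1)).
by congr (_ * _ - _ * _); congr (_ ^+ _); ring.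
Qed.

Lemma sum_Fentry : (0 < k)%N ->
  \sum_(l < d.+1) Fentry k l * Hinv_entry d l s =
  \sum_(j < k) (-1) ^+ j * 'C(k.-1, j)%:Z *
   ((2 * k%:Z - 2 * j%:Z) ^+ s * (2 * k%:Z - 2 * j%:Z + 1) ^+ (d - s)
    - (2 * k%:Z - 2 * j%:Z - 1) ^+ s * (2 * k%:Z - 2 * j%:Z) ^+ (d - s)).
Proof.
move=> k0; have sd : (s <= d)%N by rewrite -ltnS.
have hom (a : int) : \sum_(l < d.+1) a ^+ l * Hinv_entry d l s = a ^+ s * (a + 1) ^+ (d - s).
  rewrite -sum_Hinv_entry_homogeneous //; apply: eq_bigr => l _.
  by rewrite expr1n mulr1 intz mulrC.
under eq_bigr => l _ do rewrite FentryE // mulr_suml.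
rewrite exchange_big; apply: eq_bigr => j _ /=.
under eq_bigr => l _ do rewrite -[_ * _ * Hinv_entry _ _ _]mulrA [_ * Hinv_entry _ _ _]mulrBl.
by rewrite -mulr_sumr sumrB !hom subrK.
Qed.

(** The identity F M = M B.  For k = 0 there is no alternating sum; both
    sides are then 1 if s = 0 and 0 otherwise, because the identity is the only
    word that starts with a positive letter and has no descent. *)
Lemma Fentry_Bplus :
  \sum_(l < d.+1) Fentry k l * Hinv_entry d l s =
  \sum_(r < d.+1) Hinv_entry d k r * (Bplus d.+1 s.+1%:Z r)%:Z.
Proof.
rewrite sum_Bplus_cut; case: (posnP k) => [k0|k0].
  rewrite big_ord_recl big1 ?addr0 => [|l _]; last by rewrite k0 mul0r.
  rewrite k0 card_cut_perms0 mul1r /Hinv_entry leqn0 -val_eqE /=.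
  by case: eqP => [-> | //]; rewrite bin0.
by rewrite sum_Fentry // sum_cut_words.
Qed.
End PermutationSide.

Theorem theorem3p1 (d : nat) :
  (forall r s : 'I_d.+1, Rmx d r s = (Bplus d.+1 (s.+1)%:Z r)%:Z) /\
  (forall (n : nat) (D : {set {set 'I_n}}),
     is_complex D -> dim_succ D = d ->
     hvec d (Int D) = Rmx d *m hvec d D /\
     (forall r : 'I_d.+1,
        hnum (Int D) r =
        \sum_(s < d.+1) (Bplus d.+1 (s.+1)%:Z r)%:Z * hnum D s)).
Proof.
have [Hunit _] := mulmx1_unit (Hmx_Hinv_mx d).
have HV : invmx (Hmx d) = Hinv_mx d by rewrite -[RHS](mulKmx Hunit) Hmx_Hinv_mx mulmx1.
pose Bmx : 'M[int]_d.+1 := \matrix_(r, s) (Bplus d.+1 (s.+1)%:Z r)%:Z.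
have FM : Fmx d *m Hinv_mx d = Hinv_mx d *m Bmx.
  apply/matrixP=> k s; rewrite !mxE.
  rewrite (eq_bigr (fun l : 'I_d.+1 => Fentry k l * Hinv_entry d l s)) => [|l _]; last by rewrite !mxE.
  by rewrite Fentry_Bplus; apply: eq_bigr => r _; rewrite !mxE.
have RB : Rmx d = Bmx by rewrite /Rmx HV -mulmxA FM mulmxA Hmx_Hinv_mx mul1mx.
split=> [r s | n D cD dD]; first by rewrite RB mxE.
have hvecE (T : finType) (E : {set {set T}}) : dim_succ E = d ->
    hvec d E = Hmx d *m \col_(i < d.+1) (fnum E i)%:Z.
  move=> dE; apply/matrixP=> k j; rewrite !mxE /hnum dE.
  rewrite (big_ord_widen d.+1 (fun i => (-1) ^+ (k - i) * 'C(d - i, k - i)%:Z * (fnum E i)%:Z)) //.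
  rewrite big_mkcond; apply: eq_bigr => i _; rewrite !mxE ltnS.
  case: ifP => [ik | _]; last by rewrite mul0r.
  by rewrite -[in LHS]signr_odd -[in RHS]signr_odd oddB // oddD.
have hR : hvec d (Int D) = Rmx d *m hvec d D.
  rewrite !hvecE ?dim_succ_Int // /Rmx -!mulmxA; congr (_ *m _).
  rewrite mulKmx //; apply/matrixP=> k j; rewrite !mxE fnum_Int // dD.
  by apply: eq_bigr => l _; rewrite !mxE.
split=> // r; have := congr1 (fun v : 'cV_d.+1 => v r ord0) hR; rewrite !mxE => ->.
by apply: eq_bigr => s _; rewrite RB !mxE.
Qed.
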